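(* Let $f:\mathbb{R}^n\to\mathbb{R}$, $g:\mathbb{R}^n\to(-\infty,\infty]$, $L>0$, $l\in\mathbb{R}$ and $\gamma>0$ satisfy the standing assumptions in the context, and suppose that $$(1+\gamma L)^2+\frac{5\gamma l}{2}-\frac32<0 .$$ Suppose in addition that $f$ and $g$ are both bounded from below, and that at least one of them is coercive. Then any sequence $\{(y^t,z^t,x^t)\}_{t\ge1}$ generated by the Douglas-Rachford splitting method (defined in the context) with step-size parameter $\gamma$ from an initial point $x^0\in\mathbb{R}^n$ is bounded.
   Context: Standing assumptions. $f:\mathbb{R}^n\to\mathbb{R}$ is continuously differentiable and $\nabla f$ is Lipschitz continuous with a Lipschitz modulus bounded by $L>0$. $l\in\mathbb{R}$ is such that $f+\frac l2\|\cdot\|^2$ is convex. $g:\mathbb{R}^n\to(-\infty,\infty]$ is proper (its domain $\{g<+\infty\}$ is nonempty) and closed (lower semicontinuous). For the given $\gamma>0$ and every $w\in\mathbb{R}^n$, the problem $\min_u\{\gamma g(u)+\frac12\|u-w\|^2\}$ has a minimizer. Douglas-Rachford splitting method. Given $x^0\in\mathbb{R}^n$ and $\gamma>0$, for $t=0,1,2,\dots$ choose $$y^{t+1}\in\operatorname{Arg\,min}_y\Big\{f(y)+\tfrac1{2\gamma}\|y-x^t\|^2\Big\},\quad z^{t+1}\in\operatorname{Arg\,min}_z\Big\{g(z)+\tfrac1{2\gamma}\|2y^{t+1}-x^t-z\|^2\Big\},\quad x^{t+1}=x^t+(z^{t+1}-y^{t+1}).$$ A function $h$ is coercive if $\liminf_{\|x\|\to\infty}h(x)=\infty$.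 *)

(* Defs.v *)
From mathcomp Require Import all_boot all_order all_algebra.
From mathcomp Require Import all_classical all_reals all_analysis.
Import Order.TTheory GRing.Theory Num.Theory.
Import numFieldNormedType.Exports.

Set Implicit Arguments.
Unset Strict Implicit.
Unset Printing Implicit Defensive.

Local Open Scope classical_set_scope.
Local Open Scope ring_scope.

(* The library norm `|u| on 'rV[R]_n is the sup norm; every quantitative
   occurrence of a norm below uses the Euclidean one. *)
Definition enorm (R : realType) (n : nat) (u : 'rV[R]_n) : R :=
  Num.sqrt (\sum_i u 0 i ^+ 2).

Definition grad (R : realType) (n : nat) (f : 'rV[R]_n -> R) (x : 'rV[R]_n) :
    'rV[R]_n :=
  \row_i 'D_(delta_mx 0 i) f x.

Definition continuously_differentiable (R : realType) (n : nat)
    (f : 'rV[R]_n -> R) : Prop :=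
  (forall x, differentiable f x) /\ continuous (grad f).

Definition argmin (T : Type) (disp : Order.disp_t) (U : porderType disp)
    (h : T -> U) : set T :=
  [set u | forall v, (h u <= h v)%O].

Definition proper_fun (R : realType) (T : Type) (g : T -> \bar R) : Prop :=
  (forall x, -oo < g x)%E /\ (exists x, g x < +oo)%E.

(* The filter "||x|| -> oo". When n = 0 it contains the
   empty set, so every function is coercive, as liminf over nothing is +oo. *)
Definition infty_nbhs (R : realType) (n : nat) : set_system 'rV[R]_n :=
  [set A | exists M : R, forall x, M < enorm x -> A x].

Definition coercive (R : realType) (n : nat) (h : 'rV[R]_n -> \bar R) : Prop :=
  limf_einf h (@infty_nbhs R n) = +oo%E.

(* The values y 0 and z 0 are not part of the method and are unconstrained. *)
Definition DR_sequence (R : realType) (n : nat) (f : 'rV[R]_n -> R)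
    (g : 'rV[R]_n -> \bar R) (gamma : R) (x0 : 'rV[R]_n)
    (y z x : nat -> 'rV[R]_n) : Prop :=
  x 0%N = x0 /\
  forall t : nat,
  [/\ argmin (fun u => f u + 1 / (2 * gamma) * enorm (u - x t) ^+ 2) (y t.+1),
      argmin (fun u =>
        (g u + (1 / (2 * gamma) * enorm (2 *: y t.+1 - x t - u) ^+ 2)%:E)%E)
        (z t.+1)
    & x t.+1 = x t + (z t.+1 - y t.+1)].

(* Main.v *)
Require Import Defs.
From mathcomp Require Import all_boot all_order all_algebra.
From mathcomp Require Import all_classical all_reals all_analysis.
From mathcomp Require Import ring lra.
Import Order.TTheory GRing.Theory Num.Theory.
Import numFieldNormedType.Exports.

Local Open Scope classical_set_scope.
Local Open Scope ring_scope.

(** The optimality condition of the [y]-step reads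
    [x t = y t.+1 + gamma *: grad f (y t.+1)], so the method is governed by [y]
    and [z] alone, and its usual merit function reduces to the [envelope]
    [E t = f y + g z + dot (grad f y) (z - y) + |z - y|^2 / (2 * gamma)] at
    [y = y t.+1] and [z = z t.+1].

    The envelope decreases along the iteration. Substituting the formula for
    [x t] in the [z]-step shows that [z t.+1] minimizes the envelope whose first
    argument is [y t.+1] ([envelope_argmin_le]). Substituting it in the [x]-step
    gives [z t.+1 = y t.+2 + gamma *: (grad f (y t.+2) - grad f (y t.+1))], and
    for such a [z] the replacement of [y t.+1] by [y t.+2] does not increase the
    envelope ([envelope_step_le]): the gain from the proximal term and the weak
    convexity of [f] dominates the loss [gamma * |grad f (y t.+2)
    - grad f (y t.+1)|^2] as soon as
    [gamma * l + 2 * (gamma * L) ^+ 2 <= 1].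

    On the other hand, by the descent lemma, the envelope is at least
    [f z + g z + (1 / (2 * gamma) - L / 2) * |z - y|^2] ([envelope_ge]), with a
    positive last coefficient when [gamma * L < 1]. As [E t <= E 0] and [f], [g]
    are bounded below, the values [f z] and [g z] are bounded above and
    [|z - y|] is bounded. Coercivity of [f] or [g] bounds [z], hence [y], hence
    [grad f y] by the Lipschitz property, hence [x].

    Both inequalities on [gamma] follow from the step size hypothesis and
    [- L <= l] ([step_size_bounds]). The latter holds in positive dimension,
    because [f] cannot be convex beyond what its Lipschitz gradient allows
    ([weak_convexity_ge]). *)

(** * The Euclidean inner product on row vectors *)

Definition dot {R : realType} {n : nat} (u v : 'rV[R]_n) : R :=
  \sum_i u 0 i * v 0 i.

Lemma dotC {R : realType} {n : nat} (u v : 'rV[R]_n) : dot u v = dot v u.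
Proof. by apply: eq_bigr => i _; rewrite mulrC. Qed.

Lemma dotDl {R : realType} {n : nat} (u v w : 'rV[R]_n) :
  dot (u + v) w = dot u w + dot v w.
Proof. by rewrite -big_split; apply: eq_bigr => i _; rewrite mxE mulrDl. Qed.

Lemma dotZl {R : realType} {n : nat} (k : R) (u w : 'rV[R]_n) :
  dot (k *: u) w = k * dot u w.
Proof. by rewrite mulr_sumr; apply: eq_bigr => i _; rewrite mxE mulrA. Qed.

Lemma dotNl {R : realType} {n : nat} (u w : 'rV[R]_n) : dot (- u) w = - dot u w.
Proof. by rewrite -scaleN1r dotZl mulN1r. Qed.

Lemma dotDr {R : realType} {n : nat} (u v w : 'rV[R]_n) :
  dot u (v + w) = dot u v + dot u w.
Proof. by rewrite dotC dotDl !(dotC u). Qed.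

Lemma dotZr {R : realType} {n : nat} (k : R) (u w : 'rV[R]_n) :
  dot u (k *: w) = k * dot u w.
Proof. by rewrite dotC dotZl dotC. Qed.

Lemma dotNr {R : realType} {n : nat} (u w : 'rV[R]_n) : dot u (- w) = - dot u w.
Proof. by rewrite dotC dotNl dotC. Qed.

Definition dotE := (@dotDl, @dotDr, @dotNl, @dotNr, @dotZl, @dotZr).

Lemma dot_ge0 {R : realType} {n : nat} (u : 'rV[R]_n) : 0 <= dot u u.
Proof. by apply: sumr_ge0 => i _; rewrite -expr2 sqr_ge0. Qed.

Lemma dot_eq0 {R : realType} {n : nat} (u : 'rV[R]_n) : dot u u <= 0 -> u = 0.
Proof.
move=> u0; apply/rowP => i; rewrite mxE; apply/eqP; rewrite -sqrf_eq0 expr2.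
have /eqP : dot u u = 0 by apply: le_anti; rewrite u0 dot_ge0.
rewrite psumr_eq0 => [/allP/(_ i (mem_index_enum i))//|j _].
by rewrite -expr2 sqr_ge0.
Qed.

Lemma enorm_sqr {R : realType} {n : nat} (u : 'rV[R]_n) :
  enorm u ^+ 2 = dot u u.
Proof.
rewrite /enorm (eq_bigr (fun i => u 0 i * u 0 i)) => [|i _].
  by rewrite sqr_sqrtr // dot_ge0.
by rewrite expr2.
Qed.

Lemma enorm_ge0 {R : realType} {n : nat} (u : 'rV[R]_n) : 0 <= enorm u.
Proof. exact: sqrtr_ge0. Qed.

Lemma le_enorm_sqr {R : realType} {n : nat} (k : R) (u v : 'rV[R]_n) :
  0 <= k -> enorm u <= k * enorm v -> dot u u <= k ^+ 2 * dot v v.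
Proof.
move=> k0; rewrite -!enorm_sqr -exprMn => uv.
by rewrite ler_sqr// nnegrE ?mulr_ge0 ?enorm_ge0.
Qed.

(** Cauchy-Schwarz in the only form used below: expand the square of
    [u - k *: v]. *)
Lemma dot_le_scale {R : realType} {n : nat} (k : R) (u v : 'rV[R]_n) :
  0 < k -> dot u u <= k ^+ 2 * dot v v -> dot u v <= k * dot v v.
Proof.
move=> k0 uv; rewrite -(ler_pM2l k0).
have := dot_ge0 (u - k *: v); rewrite !dotE (dotC v u); lra.
Qed.

Lemma dotD_le {R : realType} {n : nat} (u v : 'rV[R]_n) :
  dot (u + v) (u + v) <= 2 * dot u u + 2 * dot v v.
Proof. have := dot_ge0 (u - v); rewrite !dotE (dotC v u); lra. Qed.

(** Passes from the squared Euclidean norm to the sup norm without square roots,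
    thanks to [`|a| <= 1 + a ^+ 2]. *)
Lemma norm_le_dot {R : realType} {n : nat} (u : 'rV[R]_n) :
  `|u| <= 1 + dot u u.
Proof.
have h : 0 <= 1 + dot u u by rewrite addr_ge0 ?dot_ge0.
rewrite [`|u|]mx_normrE; apply: bigmax_le => // -[i j] _ /=.
rewrite (ord1 i) /dot (bigD1 j)//=.
set S := \sum_(_ < _ | _) _.
have S0 : 0 <= S by apply: sumr_ge0 => k _; rewrite -expr2 sqr_ge0.
apply: le_trans (_ : 1 + u 0 j ^+ 2 <= _); last by rewrite expr2; lra.
by rewrite /= ler_norml; apply/andP; split; nra.
Qed.

(** * Differentiable functions along a line *)

Lemma dot_grad {R : realType} {n : nat} (f : 'rV[R]_n -> R) (p v : 'rV[R]_n) :
  differentiable f p -> 'D_v f p = dot (grad f p) v.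
Proof.
move=> df; rewrite (deriveE _ df) [X in 'd f p X]row_sum_delta linear_sum.
apply: eq_bigr => i _; rewrite linearZ /= /grad mxE (deriveE _ df).
by rewrite mulrC.
Qed.

Lemma is_derive_line {R : realType} {n : nat} (f : 'rV[R]_n -> R)
    (p v : 'rV[R]_n) (s : R) :
  differentiable f (p + s *: v) ->
  is_derive s 1 (fun s => f (p + s *: v)) (dot (grad f (p + s *: v)) v).
Proof.
move=> df; have dfv : derivable f (p + s *: v) v by exact: diff_derivable.
rewrite -(dot_grad _ _ _ df).
have E : (fun h : R => h^-1 *: (f (p + (h *: 1 + s) *: v) - f (p + s *: v))) =
    (fun h : R => h^-1 *: (f (h *: v + (p + s *: v)) - f (p + s *: v))).
  by apply: funext => h; rewrite [h *: 1]mulr1 scalerDl addrCA.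
split; first by rewrite /derivable /= /shift /= E.
by rewrite /derive /= /shift /= E.
Qed.

(** A one-sided Fermat rule: the difference quotients at [0] from the right are
    nonpositive. It yields both the tangent inequality of a weakly convex
    function and the first-order optimality condition of the [y]-step. *)
Lemma derive_le0_at_right_max {R : realType} (psi : R -> R) (d : R) :
  is_derive (0 : R) (1 : R) psi d ->
  (forall s, 0 < s <= 1 -> psi s <= psi 0) -> d <= 0.
Proof.
move=> [dpsi <-] le_psi.
have := dpsi; rewrite /derivable => /cvg_ex [l /= hl].
rewrite /derive (cvg_lim _ hl)//.
have hr := cvg_dnbhs_at_right hl.
rewrite -(cvg_lim _ hr)//; apply: limr_le; first by apply/cvg_ex; exists l.
near=> h.
have h0 : 0 < h by near: h; exact: nbhs_right_gt.
rewrite addr0 [h *: 1]mulr1 [_ *: _]mulrC pmulr_lle0 ?invr_gt0// subr_le0.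
by apply: le_psi; rewrite h0; near: h; apply: nbhs_right_le.
Unshelve. all: by end_near. Qed.

(** * Quadratic bounds and first-order optimality *)

(** Along the segment, [f] minus the claimed upper bound has derivative
    [dot (grad f (p + s *: v) - grad f p) v - L * s * dot v v], nonpositive by
    the Lipschitz hypothesis; the mean value theorem concludes. *)
Lemma descent_lemma {R : realType} {n : nat} (f : 'rV[R]_n -> R) (L : R)
    (p q : 'rV[R]_n) :
  0 < L -> (forall u, differentiable f u) ->
  (forall u v, enorm (grad f u - grad f v) <= L * enorm (u - v)) ->
  f q <= f p + dot (grad f p) (q - p) + L / 2 * dot (q - p) (q - p).
Proof.
move=> L0 df lipf.
have [v ->] : exists v, q = p + v by exists (q - p); rewrite addrC subrK.
rewrite (addrAC p) subrr add0r.
pose a := dot (grad f p) v; pose b := dot v v.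
pose psi := (fun s : R => f (p + s *: v) - (s * a + s ^+ 2 * (L / 2 * b))).
pose dpsi := (fun s : R => dot (grad f (p + s *: v)) v - (a + s * (L * b))).
have psiD (s : R) : is_derive s 1 psi (dpsi s).
  apply: is_deriveB; first exact: is_derive_line.
  apply: is_derive_eq; rewrite /= /GRing.scale /= /cst /=; by field.
have psiC : {within `[0, 1], continuous psi}.
  apply: derivable_within_continuous => s _; exact: ex_derive.
have [c c01 psi10] := MVT (f := psi) ltr01 (fun s _ => psiD s) psiC.
have c0 : 0 < c by move: c01; rewrite in_itv /= => /andP[].
have : dpsi c <= 0.
  have Lc : dot (grad f (p + c *: v) - grad f p)
      (grad f (p + c *: v) - grad f p) <= (L * c) ^+ 2 * dot v v.
    apply: le_trans (le_enorm_sqr _ _ _ (ltW L0) (lipf _ _)) _.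
    have -> : p + c *: v - p = c *: v by rewrite addrC addKr.
    by rewrite !dotE; nra.
  have := dot_le_scale _ _ _ (mulr_gt0 L0 c0) Lc.
  by rewrite /dpsi /= !dotE -/a -/b; lra.
move=> dc; have : psi 1 <= psi 0 by rewrite -subr_le0 psi10; lra.
rewrite /psi /= scale1r scale0r addr0 -/a -/b; lra.
Qed.

(** The chord of [f + l / 2 * |.|^2] bounds [f] from above along the segment
    from [p] to [q] by a quadratic polynomial which agrees with [f] at [p];
    comparing the derivatives at [p] gives the tangent inequality. *)
Lemma weak_tangent {R : realType} {n : nat} (f : 'rV[R]_n -> R) (l : R)
    (p q : 'rV[R]_n) :
  differentiable f p ->
  convex_function setT (fun u : 'rV[R]_n => f u + l / 2 * enorm u ^+ 2) ->
  f p + dot (grad f p) (q - p) - l / 2 * dot (q - p) (q - p) <= f q.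
Proof.
move=> df cvxf.
have [v ->] : exists v, q = p + v by exists (q - p); rewrite addrC subrK.
rewrite (addrAC p) subrr add0r; pose b := dot v v.
pose psi := (fun s : R => f (p + s *: v) -
  (s * (f (p + v) - f p + l / 2 * b) - s ^+ 2 * (l / 2 * b))).
suff : dot (grad f p) v - (f (p + v) - f p + l / 2 * b) <= 0.
  by rewrite -/b; lra.
apply: (@derive_le0_at_right_max _ psi).
  apply: is_deriveB.
    have := @is_derive_line _ _ f p v 0; rewrite scale0r addr0; exact.
  apply: is_derive_eq; rewrite /= /GRing.scale /= /cst /=; by field.
move=> s /andP[s0 s1].
have := cvxf (Itv01 (ltW s0) s1) (p + v) p (in_setT _) (in_setT _).
rewrite convRE /= /unstable.onem /conv /= /unstable.onem.
have -> : s *: (p + v) + (1 - s) *: p = p + s *: v.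
  by rewrite scalerDr addrAC -scalerDl (addrC s) subrK scale1r.
rewrite !enorm_sqr /psi /= scale0r addr0.
rewrite /b !dotE (dotC v p); lra.
Qed.

(** The optimality condition [grad f p + gamma^-1 *: (p - x) = 0] of the
    proximal step, solved for [x]. *)
Lemma argmin_grad {R : realType} {n : nat} (f : 'rV[R]_n -> R) (gamma : R)
    (x p : 'rV[R]_n) :
  0 < gamma -> differentiable f p ->
  argmin (fun u => f u + 1 / (2 * gamma) * enorm (u - x) ^+ 2) p ->
  x = p + gamma *: grad f p.
Proof.
move=> g0 df pmin; pose w := grad f p + gamma^-1 *: (p - x).
have wv v : - dot w v <= 0.
  pose c := gamma^-1 / 2.
  pose psi := (fun s : R => - (f (p + s *: v) +
    (s * (2 * c * dot (p - x) v) + s ^+ 2 * (c * dot v v)))).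
  apply: (@derive_le0_at_right_max _ psi).
    apply: is_deriveN.
    have -> : dot w v = dot (grad f p) v + 2 * c * dot (p - x) v.
      by rewrite /w /c dotDl dotZl; field; rewrite gt_eqF.
    apply: is_deriveD.
      have := @is_derive_line _ _ f p v 0; rewrite scale0r addr0; exact.
    apply: is_derive_eq; rewrite /= /GRing.scale /= /cst /=; by field.
  move=> s _; have := pmin (p + s *: v).
  have cE : 1 / (2 * gamma) = c by rewrite /c; field; rewrite gt_eqF.
  rewrite cE !enorm_sqr -(addrAC p) (dotDl (p - x)) !(dotDr _ (p - x)).
  rewrite /psi scale0r addr0 !dotZl !dotZr (dotC v (p - x)); lra.
have /dot_eq0 w0 : dot w w <= 0 by have := wv (- w); rewrite dotNr; lra.
have /(congr1 (fun u => gamma *: u)) := w0.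
rewrite scaler0 scalerDr scalerA divff ?gt_eqF// scale1r => /eqP.
by rewrite addrA subr_eq0 addrC => /eqP.
Qed.

(** * Constraints on the parameters *)

(** The quadratic upper bound with constant [L] and the lower bound with
    constant [- l] hold around the same point, so they can only be compatible
    if [- l <= L]; a nonzero vector is needed to see it. *)
Lemma weak_convexity_ge {R : realType} {n : nat} (f : 'rV[R]_n -> R) (L l : R) :
  (0 < n)%N -> 0 < L -> (forall u, differentiable f u) ->
  (forall u v, enorm (grad f u - grad f v) <= L * enorm (u - v)) ->
  convex_function setT (fun u : 'rV[R]_n => f u + l / 2 * enorm u ^+ 2) ->
  - L <= l.
Proof.
move=> n0 L0 df lipf cvxf; pose v : 'rV[R]_n := \row__ 1.
have v0 : 0 < dot v v.
  rewrite /dot (eq_bigr (fun=> 1)) => [|i _]; last by rewrite mxE mulr1.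
  by rewrite sumr_const card_ord ltr0n.
have := weak_tangent _ _ 0 v (df 0) cvxf.
have := descent_lemma _ _ 0 v L0 df lipf.
by rewrite subr0 => ub lb; rewrite -(ler_pM2r v0); lra.
Qed.

(** With [s = gamma * L] and [m = gamma * l >= - s], the hypothesis gives
    [(s - 1) * (s + 1 / 2) < 0], hence [s < 1]. Bounding [m] by the
    hypothesis then gives
    [m + 2 * s ^+ 2 - 1 < 4 / 5 * (2 * s + 1) * (s - 1) < 0]. *)
Lemma step_size_bounds {R : realType} (L l gamma : R) :
  0 < L -> 0 < gamma -> - L <= l ->
  (1 + gamma * L) ^+ 2 + 5 * gamma * l / 2 - 3 / 2 < 0 ->
  gamma * L < 1 /\ gamma * l + 2 * (gamma * L) ^+ 2 <= 1.
Proof.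
move=> L0 g0 lL; have s0 : 0 < gamma * L by rewrite mulr_gt0.
have : gamma * - L <= gamma * l by rewrite ler_pM2l.
rewrite mulrN -(mulrA 5); move: (gamma * L) (gamma * l) s0 => s m s0 ms sm.
have s1 : s < 1 by nra.
by split => //; nra.
Qed.

(** * The envelope of the splitting method *)

(** For [c = g z], this is the objective of the proximal gradient step from
    [y]: the linearization of [f] at [y], plus [g], plus the proximal term. Its
    minimum over [z] is the forward-backward envelope of [f + g] at [y], which
    is also the Douglas-Rachford envelope at [y + gamma *: grad f y]. The value
    [c] is a separate real argument to keep extended reals out of the
    computations. *)
Definition envelope {R : realType} {n : nat} (f : 'rV[R]_n -> R) (gamma : R)
    (y z : 'rV[R]_n) (c : R) : R :=
  f y + c + dot (grad f y) (z - y) + 1 / (2 * gamma) * dot (z - y) (z - y).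

(** By the descent lemma, [f y + dot (grad f y) (z - y)] is at least
    [f z - L / 2 * dot (z - y) (z - y)]. *)
Lemma envelope_ge {R : realType} {n : nat} (f : 'rV[R]_n -> R) (L gamma : R)
    (y z : 'rV[R]_n) (c : R) :
  0 < L -> (forall u, differentiable f u) ->
  (forall u v, enorm (grad f u - grad f v) <= L * enorm (u - v)) ->
  f z + c + (1 / (2 * gamma) - L / 2) * dot (z - y) (z - y) <=
    envelope f gamma y z c.
Proof.
move=> L0 df lipf; have := descent_lemma _ _ y z L0 df lipf.
rewrite /envelope; lra.
Qed.

(** With [x = y + gamma *: grad f y] the reflected point [2 *: y - x] is the
    gradient step [y - gamma *: grad f y], and completing the square turns the
    objective of the [z]-step into the envelope, up to a term that depends only
    on [y]. *)
Lemma envelope_argmin_le {R : realType} {n : nat} (f : 'rV[R]_n -> R)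
    (g : 'rV[R]_n -> \bar R) (gamma : R) (y z z' : 'rV[R]_n) (c c' : R) :
  0 < gamma -> g z = c%:E -> g z' = c'%:E ->
  argmin (fun u => (g u + (1 / (2 * gamma) *
    enorm (2 *: y - (y + gamma *: grad f y) - u) ^+ 2)%:E)%E) z ->
  envelope f gamma y z c <= envelope f gamma y z' c'.
Proof.
move=> g0 gz gz' /(_ z'); rewrite gz gz' -!EFinD lee_fin.
have E u : 1 / (2 * gamma) *
    enorm (2 *: y - (y + gamma *: grad f y) - u) ^+ 2 =
    dot (grad f y) (u - y) + 1 / (2 * gamma) * dot (u - y) (u - y) +
    gamma / 2 * dot (grad f y) (grad f y).
  rewrite enorm_sqr !dotE (dotC u y) (dotC y (grad f y)) (dotC u (grad f y)).
  by field; rewrite gt_eqF.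
by rewrite !E /envelope; lra.
Qed.

(** Write [d = y' - y] and [w = grad f y' - grad f y]. The envelope at [y]
    exceeds the one at [y'] by
    [f y - f y' + dot (grad f y') d + dot d d / (2 * gamma) - gamma * dot w w].
    Weak convexity bounds the first three terms below by [- l / 2 * dot d d],
    and [dot w w <= L ^+ 2 * dot d d], so the step size condition makes this
    excess nonnegative. *)
Lemma envelope_step_le {R : realType} {n : nat} (f : 'rV[R]_n -> R)
    (L l gamma : R) (y y' z : 'rV[R]_n) (c : R) :
  0 < L -> 0 < gamma -> gamma * l + 2 * (gamma * L) ^+ 2 <= 1 ->
  (forall u, differentiable f u) ->
  (forall u v, enorm (grad f u - grad f v) <= L * enorm (u - v)) ->
  convex_function setT (fun u : 'rV[R]_n => f u + l / 2 * enorm u ^+ 2) ->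
  z = y' + gamma *: (grad f y' - grad f y) ->
  envelope f gamma y' z c <= envelope f gamma y z c.
Proof.
move=> L0 g0 step df lipf cvxf ->.
have := weak_tangent _ _ y' y (df y') cvxf.
have := le_enorm_sqr _ _ _ (ltW L0) (lipf y' y).
rewrite /envelope.
have [d ->] : exists d, y' = y + d by exists (y' - y); rewrite addrC subrK.
have [w ->] : exists w, grad f (y + d) = grad f y + w.
  by exists (grad f (y + d) - grad f y); rewrite [RHS]addrC subrK.
move: (f (y + d)) => fy'; set p := grad f y.
have -> : y + d - y = d by rewrite addrAC subrr add0r.
have -> : y - (y + d) = - d by rewrite opprD addrA subrr add0r.
have -> : p + w - p = w by rewrite addrAC subrr add0r.
have -> : y + d + gamma *: w - (y + d) = gamma *: w.
  by rewrite addrAC subrr add0r.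
have -> : y + d + gamma *: w - y = d + gamma *: w.
  by rewrite -(addrA y) (addrAC y) subrr add0r.
rewrite !dotE (dotC w d) => ww tang.
have E : 1 / (2 * gamma) * (gamma * (gamma * dot w w)) = gamma / 2 * dot w w.
  by field; rewrite gt_eqF.
have E2 : 1 / (2 * gamma) * (gamma * dot d w) = dot d w / 2.
  by field; rewrite gt_eqF.
rewrite !mulrDr E E2.
have d0 := dot_ge0 d.
have : gamma * dot w w <= (1 / (2 * gamma) - l / 2) * dot d d.
  rewrite -(ler_pM2l g0).
  have -> : gamma * ((1 / (2 * gamma) - l / 2) * dot d d) =
    (1 - gamma * l) / 2 * dot d d by field; rewrite gt_eqF.
  have : gamma ^+ 2 * dot w w <= gamma ^+ 2 * (L ^+ 2 * dot d d).
    by rewrite ler_pM2l// exprn_gt0.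
  have : (gamma * l + 2 * (gamma * L) ^+ 2) * dot d d <= 1 * dot d d.
    exact: ler_wpM2r.
  lra.
by lra.
Qed.

(** * Coercivity and finiteness *)

Lemma coercive_sublevel {R : realType} {n : nat} (h : 'rV[R]_n -> \bar R)
    (M : R) :
  coercive h -> exists K, forall u, (h u <= M%:E)%E -> dot u u <= K.
Proof.
rewrite /coercive limf_einfE => supE.
have : (M%:E < ereal_sup [set ereal_inf (h @` V) | V in @infty_nbhs R n])%E.
  by rewrite supE ltry.
move=> /ereal_sup_gt[_ [V [K VK] <-] MV].
exists (K ^+ 2) => u hu; rewrite -enorm_sqr.
have uK : enorm u <= K.
  rewrite leNgt; apply/negP => /VK Vu.
  suff : (M%:E < M%:E)%E by rewrite ltxx.
  apply: lt_le_trans MV (le_trans _ hu); apply: ereal_inf_lbound.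
  by exists u.
by rewrite ler_sqr// nnegrE ?enorm_ge0// (le_trans _ uK) ?enorm_ge0.
Qed.

Lemma argmin_fin_num {R : realType} {T : Type} (g : T -> \bar R) (k : T -> R)
    (z : T) :
  proper_fun g -> argmin (fun u => (g u + (k u)%:E)%E) z ->
  g z \is a fin_num.
Proof.
move=> [gNy [u guy]] /(_ u) gz; rewrite fin_real// gNy/=.
have : (g z + (k z)%:E < +oo)%E.
  by apply: le_lt_trans gz _; rewrite lte_add_pinfty// ltry.
by case: (g z) => //= r _; rewrite ltry.
Qed.

(** * Boundedness of the iterates *)

Theorem theorem4 (R : realType) (n : nat)
  (f : 'rV[R]_n -> R) (g : 'rV[R]_n -> \bar R) (L l gamma : R)
  (L_gt0 : 0 < L) (gamma_gt0 : 0 < gamma)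
  (f_C1 : continuously_differentiable f)
  (f_lip : forall u v : 'rV[R]_n,
     enorm (grad f u - grad f v) <= L * enorm (u - v))
  (f_weakly_convex :
     convex_function setT (fun u : 'rV[R]_n => f u + l / 2 * enorm u ^+ 2))
  (g_proper : proper_fun g)
  (g_closed : lower_semicontinuous g)
  (g_prox : forall w : 'rV[R]_n,
     argmin (fun u : 'rV[R]_n =>
       (gamma%:E * g u + (1 / 2 * enorm (u - w) ^+ 2)%:E)%E) !=set0)
  (gamma_small : (1 + gamma * L) ^+ 2 + 5 * gamma * l / 2 - 3 / 2 < 0)
  (f_bounded_below : exists m : R, forall u, m <= f u)
  (g_bounded_below : exists m : R, forall u, (m%:E <= g u)%E)
  (fg_coercive : coercive (fun u => (f u)%:E) \/ coercive g)
  (x0 : 'rV[R]_n) (y z x : nat -> 'rV[R]_n)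
  (yzx_DR : DR_sequence f g gamma x0 y z x) :
  [bounded (y t, z t, x t) | t in [set t : nat | (0 < t)%N]].
Proof.
have df := f_C1.1.
(* In dimension 0 the parameter l may be below - L, but all vectors vanish. *)
have [n0 | n_gt0] := posnP n.
  have norm_le1 (u : 'rV[R]_n) : `|u| <= 1.
    apply: le_trans (norm_le_dot u) _.
    by subst n; rewrite /dot big_ord0 addr0.
  exists 1; split; first exact: num_real.
  move=> N N1 t _ /=; rewrite !prod_normE /= !ge_max.
  by rewrite !(le_trans (norm_le1 _) (ltW N1)).
have lL := weak_convexity_ge _ _ _ n_gt0 L_gt0 df f_lip f_weakly_convex.
have [gL1 step] := step_size_bounds _ _ _ L_gt0 gamma_gt0 lL gamma_small.
have [_ DRstep] := yzx_DR.
have xE t : x t = y t.+1 + gamma *: grad f (y t.+1).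
  by have [ymin _ _] := DRstep t; exact: argmin_grad ymin.
(* x t.+1 = x t + (z t.+1 - y t.+1), with both x t and x t.+1 expressed by
   gradients. *)
have zE t : z t.+1 = y t.+2 + gamma *: (grad f (y t.+2) - grad f (y t.+1)).
  have [_ _] := DRstep t; rewrite !xE => /eqP.
  rewrite -subr_eq => /eqP xz.
  by apply/rowP => i; move/rowP/(_ i): xz; rewrite !mxE; lra.
pose G t := fine (g (z t.+1)).
have gz t : g (z t.+1) = (G t)%:E.
  rewrite /G fineK//; have [_ zmin _] := DRstep t.
  exact: argmin_fin_num g_proper zmin.
pose E t := envelope f gamma (y t.+1) (z t.+1) (G t).
have E_le t : E t <= E 0.
  elim: t => // t; apply: le_trans.
  apply: (@le_trans _ _ (envelope f gamma (y t.+2) (z t.+1) (G t))).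
    have [_ zmin _] := DRstep t.+1; rewrite xE in zmin.
    exact: envelope_argmin_le gamma_gt0 (gz _) (gz _) zmin.
  exact: envelope_step_le L_gt0 gamma_gt0 step df f_lip f_weakly_convex (zE t).
have [mf f_ge] := f_bounded_below; have [mg g_ge] := g_bounded_below.
(* The coefficient of |z - y|^2 left in the lower bound of the envelope; it is
   positive because gamma * L < 1. *)
pose b := 1 / (2 * gamma) - L / 2.
have b0 : 0 < b.
  have -> : b = (1 - gamma * L) / (2 * gamma).
    by rewrite /b; field; rewrite gt_eqF.
  by rewrite divr_gt0 ?subr_gt0 ?mulr_gt0.
have E_ge t :
    f (z t.+1) + G t + b * dot (z t.+1 - y t.+1) (z t.+1 - y t.+1) <= E 0.
  apply: le_trans (E_le t).
  exact: (envelope_ge _ _ gamma (y t.+1) (z t.+1) (G t) L_gt0 df f_lip).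
have G_ge t : mg <= G t by rewrite -lee_fin -gz.
have zy_ge0 t : 0 <= b * dot (z t.+1 - y t.+1) (z t.+1 - y t.+1).
  by rewrite mulr_ge0 ?dot_ge0// ltW.
have [Kz z_le] : exists K, forall t, dot (z t.+1) (z t.+1) <= K.
  have [/(coercive_sublevel _ (E 0 - mg))[K hK]|
        /(coercive_sublevel _ (E 0 - mf))[K hK]] := fg_coercive;
    exists K => t; apply: hK; rewrite ?gz lee_fin.
    by move: (E_ge t) (G_ge t) (zy_ge0 t); lra.
  by move: (E_ge t) (f_ge (z t.+1)) (zy_ge0 t); lra.
pose Ky := 2 * Kz + 2 * ((E 0 - mf - mg) / b).
have y_le t : dot (y t.+1) (y t.+1) <= Ky.
  have -> : y t.+1 = z t.+1 + - (z t.+1 - y t.+1) by rewrite opprB addrC subrK.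
  apply: le_trans (dotD_le _ _) _; rewrite lerD ?ler_pM2l//.
  rewrite dotNl dotNr opprK ler_pdivlMr// mulrC.
  by move: (E_ge t) (f_ge (z t.+1)) (G_ge t); lra.
pose Kp := 2 * dot (grad f 0) (grad f 0) + 2 * (L ^+ 2 * Ky).
have p_le t : dot (grad f (y t.+1)) (grad f (y t.+1)) <= Kp.
  have -> : grad f (y t.+1) = grad f 0 + (grad f (y t.+1) - grad f 0).
    by rewrite addrC subrK.
  apply: le_trans (dotD_le _ _) _; rewrite lerD2l ler_pM2l//.
  apply: le_trans (le_enorm_sqr _ _ _ (ltW L_gt0) (f_lip _ _)) _.
  by rewrite subr0 ler_pM2l// exprn_gt0.
pose Kx := 2 * Kz + 2 * (gamma ^+ 2 * Kp).
have x_le t : dot (x t.+1) (x t.+1) <= Kx.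
  have -> : x t.+1 = z t.+1 + gamma *: grad f (y t.+1).
    by have [_ _ ->] := DRstep t; rewrite xE addrC addrA subrK.
  apply: le_trans (dotD_le _ _) _; rewrite lerD ?ler_pM2l//.
  by rewrite dotZl dotZr mulrA -expr2 ler_pM2l// exprn_gt0.
exists (1 + Num.max Ky (Num.max Kz Kx)); split; first exact: num_real.
move=> N; rewrite -ltrBrDl !gt_max => /and3P[KyN KzN KxN] [|t]// _ /=.
rewrite !prod_normE /= !ge_max -andbA.
apply/and3P; split; apply: le_trans (norm_le_dot _) _; rewrite -lerBrDl.
- exact: le_trans (y_le t) (ltW KyN).
- exact: le_trans (z_le t) (ltW KzN).
- exact: le_trans (x_le t) (ltW KxN).
Qed.
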